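(* Let $\nu$ be the zero-mean $k$-variate complex Gaussian distribution on $\mathbb C^k$ with covariance matrix $\Sigma$. Let $\mathcal D\subset\Omega_m^k$ be a set of $n\ge1$ nodes and let $f=\sum_{\alpha\in\mathbb Z_m^k}b_\alpha z^\alpha$ be the polynomial representation of its indicator function over $\Omega_m^k$. Let $S\subset S_m$ be a set of monomials such that the pair $(\mathcal D,\operatorname{Span}_{\mathbb C}(S))$ is correct, and let $$w_S=\left(X_{\mathcal D,S}^t\right)^{-1}\left[\int_{\mathbb C^k}s\,d\nu\right]_{s\in S},\qquad X_{\mathcal D,S}=[s(d)]_{d\in\mathcal D,\,s\in S}.$$ Then $w_S=\frac1n1_n$ if and only if $S\cap\operatorname{Supp}(f)=\{1\}$.
   Context: The zero-mean $k$-variate complex Gaussian distribution with (Hermitian positive definite) covariance matrix $\Sigma=E(Z\overline Z^t)$ is the probability measure on $\mathbb C^k$ with density $\frac{1}{\pi^k\det(\Sigma)}\exp(-\overline z^t\Sigma^{-1}z)$ with respect to Lebesgue measure on $\mathbb C^k\cong\mathbb R^{2k}$. Here $m\ge1$ is an integer and $\Omega_m\subset\mathbb C$ is the set of $m$-th roots of unity. For $\alpha\in\mathbb Z_{\ge0}^k$, $z^\alpha=z_1^{\alpha_1}\cdots z_k^{\alpha_k}$. $\mathbb Z_m$ is identified with $\{0,\dots,m-1\}$, and $S_m=\{z^\alpha:\alpha\in\mathbb Z_m^k\}=\{z^\alpha:0\le\alpha_i\le m-1\}$. For $\alpha\in\mathbb Z_m^k$, $\overline\alpha\in\mathbb Z_m^k$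 denotes the vector of residues of $m-\alpha_i$ modulo $m$. The indicator function of $\mathcal D$ over $\Omega_m^k$ (equal to $1$ on $\mathcal D$ and $0$ on $\Omega_m^k\setminus\mathcal D$) is represented by the unique interpolating polynomial $f=\sum_{\alpha\in\mathbb Z_m^k}b_\alpha z^\alpha\in\operatorname{Span}_{\mathbb C}(S_m)$, with $b_\alpha=\frac1{m^k}\sum_{d\in\mathcal D}z^{\overline\alpha}(d)$. $\operatorname{Supp}(f)=\{z^\alpha:\alpha\in\mathbb Z_m^k,\ b_\alpha\ne0\}$. The pair $(\mathcal D,\mathcal P)$, with $\mathcal P$ a set of polynomials, is correct if for every $g:\mathbb C^k\to\mathbb C$ there is a unique $p\in\mathcal P$ with $p(d)=g(d)$ for all $d\in\mathcal D$; for $\mathcal P=\operatorname{Span}_{\mathbb C}(S)$ this is equivalent to $X_{\mathcal D,S}$ being square and non-singular. $1_n$ is the all-ones vector of length $n$; in $\{1\}$, $1$ is the monomial $z^0$. *)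

(* Defs.v *)
From HB Require Import structures.
From mathcomp Require Import all_boot all_order all_algebra.
From mathcomp Require Import complex finmap.
(* mpoly has notations that clash with the analysis library, and a module
   [Measure] that must not shadow the one of measure theory. *)
From mathcomp Require Import -(notations) mpoly.
From mathcomp Require Import all_classical all_reals all_analysis.

Set Implicit Arguments.
Unset Strict Implicit.
Unset Printing Implicit Defensive.

Import Order.TTheory GRing.Theory Num.Theory.
Import numFieldNormedType.Exports.

Local Open Scope classical_set_scope.
Local Open Scope complex_scope.
Local Open Scope ring_scope.

(* The instance in the library that makes [m1 \x m2] sigma-finite is shadowed by
   the one for subprobabilities, hence this alias. *)
Section sigma_finite_product.
Context d1 d2 (T1 : measurableType d1) (T2 : measurableType d2) (R : realType).
Variable m1 : {sigma_finite_measure set T1 -> \bar R}.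
Variable m2 : {sigma_finite_measure set T2 -> \bar R}.
Local Open Scope ereal_scope.

Definition sfproduct : set (T1 * T2) -> \bar R := m1 \x m2.

HB.instance Definition _ := Measure.on sfproduct.

Let sfproduct_sigma_finite : sigma_finite setT sfproduct.
Proof.
have /sigma_finiteP[F [TF ndF Foo]] := sigma_finiteT m1.
have /sigma_finiteP[G [TG ndG Goo]] := sigma_finiteT m2.
exists (fun n => F n `*` G n).
  rewrite -setXTT TF TG predeqE => -[x y]; split.
    move=> [/= [n _ Fnx] [k _ Gky]]; exists (maxn n k) => //; split.
    - by move: x Fnx; exact/subsetPset/ndF/leq_maxl.
    - by move: y Gky; exact/subsetPset/ndG/leq_maxr.
  by move=> [n _ []/= ? ?]; split; exists n.
move=> k; have [? ?] := Foo k; have [? ?] := Goo k.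
split; first exact: measurableX.
by rewrite /sfproduct product_measure1E// lte_mul_pinfty// ge0_fin_numE.
Qed.

HB.instance Definition _ := Measure_isSigmaFinite.Build _ _ _ sfproduct
  sfproduct_sigma_finite.

End sigma_finite_product.

(* C and C^k as measurable spaces, through C = R^2; [cvec] is the identification
   of C^k with column vectors of complex numbers. *)
Notation cplane R := (measurableTypeR R * measurableTypeR R)%type.
Notation cspace R k := (k.-tuple (cplane R)).

Definition cvec (R : realType) (k : nat) (t : cspace R k) : 'cV[R[i]]_k :=
  \col_(j < k) ((tnth t j).1 +i* (tnth t j).2 : R[i]).

Section lebesgueCk.
Variable R : realType.

Definition lebesgueC : {sigma_finite_measure set (cplane R) -> \bar R} :=
  sfproduct (@lebesgue_measure R) (@lebesgue_measure R).

Definition ccons (k : nat) (zt : (cplane R * cspace R k)%type) : cspace R k.+1 :=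
  [tuple of zt.1 :: zt.2].

Lemma measurable_ccons k :
  measurable_fun [set: (cplane R * cspace R k)%type] (@ccons k).
Proof. exact: (measurable_cons measurable_fst measurable_snd). Qed.

Section step.
Variables (k : nat) (mu : {sigma_finite_measure set (cspace R k) -> \bar R}).

Definition lebesgueCS : set (cspace R k.+1) -> \bar R :=
  pushforward (sfproduct lebesgueC mu) (@ccons k).

Let lebesgueCS0 : lebesgueCS set0 = 0%E.
Proof. by rewrite /lebesgueCS /pushforward preimage_set0 measure0. Qed.

Let lebesgueCS_ge0 A : (0 <= lebesgueCS A)%E.
Proof. exact: (@measure_ge0 _ _ _ (sfproduct lebesgueC mu)). Qed.

Let lebesgueCS_sigma_additive : semi_sigma_additive lebesgueCS.
Proof.
move=> F mF tF mUF; rewrite /lebesgueCS /pushforward preimage_bigcup.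
have mp (A : set (cspace R k.+1)) : measurable A ->
    measurable (@ccons k @^-1` A).
  by move=> mA; rewrite -[X in measurable X]setTI; exact: measurable_ccons.
apply: measure_semi_sigma_additive.
- by move=> n; exact: mp.
- apply/trivIsetP => /= i j _ _ ij; rewrite -preimage_setI.
  by move/trivIsetP : tF => /(_ _ _ _ _ ij) ->//; rewrite preimage_set0.
- by rewrite -preimage_bigcup; exact: mp.
Qed.

HB.instance Definition _ := isMeasure.Build _ _ _ lebesgueCS
  lebesgueCS0 lebesgueCS_ge0 lebesgueCS_sigma_additive.

Let lebesgueCS_sigma_finite : sigma_finite [set: cspace R k.+1] lebesgueCS.
Proof.
have [F TF Foo] := sigma_finiteT (sfproduct lebesgueC mu).
pose g (t : cspace R k.+1) : (cplane R * cspace R k)%type :=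
  (thead t, [tuple of behead t]).
have mg : measurable_fun setT g.
  apply/measurable_fun_pairP; split; first exact: measurable_tnth.
  exact: measurable_behead.
have gK : cancel (@ccons k) g.
  case=> z t; rewrite /g; set u := ccons _; have -> : thead u = z by []; congr pair.
  exact/val_inj.
exists (fun n => g @^-1` F n).
  by rewrite -preimage_bigcup -TF preimage_setT.
move=> n; have [mF Fn] := Foo n; split.
  by rewrite -[X in measurable X]setTI; exact: mg.
rewrite /lebesgueCS /pushforward -comp_preimage.
by rewrite (_ : g \o _ = id)//; apply/funext => x; exact: gK.
Qed.

HB.instance Definition _ := Measure_isSigmaFinite.Build _ _ _ lebesgueCS
  lebesgueCS_sigma_finite.

End step.

(* Lebesgue measure on C^k = R^(2k): the k-fold product of [lebesgueC]. *)
Fixpoint lebesgueCk (k : nat) : {sigma_finite_measure set (cspace R k) -> \bar R} :=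
  if k is k'.+1 then lebesgueCS (lebesgueCk k')
  else \d_([tuple] : cspace R 0).

End lebesgueCk.

Section gaussian.
Variables (R : realType) (k : nat).
Implicit Type Sigma : 'M[R[i]]_k.
Local Open Scope sesquilinear_scope.

Definition hermitian_posdef Sigma :=
  Sigma \is hermsymmx /\
  forall z : 'cV[R[i]]_k, z != 0 -> 0 < (z ^t* *m Sigma *m z) ord0 ord0.

(* [\det Sigma] and the quadratic form are real when [Sigma] is Hermitian
   positive definite, so that taking real parts loses nothing. *)
Definition gaussian_density Sigma (z : 'cV[R[i]]_k) : R :=
  (pi ^+ k * complex.Re (\det Sigma))^-1 *
  expR (- complex.Re ((z ^t* *m invmx Sigma *m z) ord0 ord0)).

Definition is_complex_gaussian Sigma (nu : probability (cspace R k) R) :=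
  forall A : set (cspace R k), measurable A ->
    nu A = (\int[lebesgueCk R k]_(t in A) (gaussian_density Sigma (cvec t))%:E)%E.

Definition cintegral (nu : {measure set (cspace R k) -> \bar R})
    (g : 'cV[R[i]]_k -> R[i]) : R[i] :=
  (\int[nu]_t complex.Re (g (cvec t))) +i* (\int[nu]_t complex.Im (g (cvec t))).

End gaussian.

Section quadrature.
Variables (R : realType) (k : nat).
Local Notation C := R[i].
Local Notation node := 'cV[C]_k.

(* A monomial z^a is given by its exponent [a : multinom k]. *)
Definition monomial (a : multinom k) : mpoly k C := mpolyX C a.

Definition peval (p : mpoly k C) (z : node) : C := meval (z ^~ ord0) p.

Definition roots_grid (m : nat) : set node :=
  [set z | forall i, z i ord0 ^+ m = 1].

Definition exponent (m : nat) (a : {ffun 'I_k -> 'I_m}) : multinom k :=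
  Multinom [tuple (a i : nat) | i < k].

Definition monomials_lt (m : nat) : {fset multinom k} :=
  [fset s in [seq exponent a | a : {ffun 'I_k -> 'I_m}]]%fset.

Definition mspan (S : {fset multinom k}) : set (mpoly k C) :=
  [set p | exists c : multinom k -> C, p = \sum_(s <- S) c s *: monomial s].

Definition is_indicator_poly (m : nat) (D : {fset node}) (f : mpoly k C) :=
  mspan (monomials_lt m) f /\
  forall z, roots_grid m z -> peval f z = (z \in D)%:R.

Definition supp (f : mpoly k C) : {fset multinom k} :=
  [fset s in msupp f]%fset.

Definition correct (D : {fset node}) (P : set (mpoly k C)) :=
  forall g : node -> C,
    exists! p, P p /\ forall d, d \in D -> peval p d = g d.

(* Rows and columns follow the enumerations of [D] and [S]. *)
Definition design_mx (D : {fset node}) (S : {fset multinom k}) :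
    'M[C]_(#|` D|, #|` S|) :=
  \matrix_(i, j) peval (monomial (tnth (in_tuple S) j)) (tnth (in_tuple D) i).

Definition moments (nu : {measure set (cspace R k) -> \bar R})
    (S : {fset multinom k}) : 'cV[C]_(#|` S|) :=
  \col_j cintegral nu (peval (monomial (tnth (in_tuple S) j))).

Lemma monomial_sum_inj (S : {fset multinom k}) (c : multinom k -> C) s :
  s \in S -> \sum_(t <- S) c t *: monomial t = 0 -> c s = 0.
Proof.
move=> sS /(congr1 (mcoeff s)); rewrite raddf0 raddf_sum /=.
rewrite (bigD1_seq s)//= mcoeffZ mcoeffX eqxx mulr1 big1 ?addr0// => t ts.
by rewrite mcoeffZ mcoeffX (negbTE ts) mulr0.
Qed.

Lemma peval_sum (S : {fset multinom k}) (c : multinom k -> C) z :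
  peval (\sum_(s <- S) c s *: monomial s) z =
  \sum_(s <- S) c s * peval (monomial s) z.
Proof.
by rewrite /peval raddf_sum; apply: eq_bigr => s _; rewrite /= mevalZ.
Qed.

Lemma design_mxE D S (c : multinom k -> C) i :
  (design_mx D S *m \col_j c (tnth (in_tuple S) j)) i ord0 =
  peval (\sum_(s <- S) c s *: monomial s) (tnth (in_tuple D) i).
Proof.
rewrite peval_sum (big_tnth _ _ (enum_fset S)) mxE.
by apply: eq_bigr => j _; rewrite !mxE mulrC.
Qed.

Lemma coef_col (S : {fset multinom k}) (v : 'cV[C]_(#|` S|)) :
  exists c, v = \col_j c (tnth (in_tuple S) j).
Proof.
exists (fun s => if insub (index s S) is Some j then v j ord0 else 0).
apply/colP => j; rewrite mxE.
have -> : index (tnth (in_tuple S) j) S = j.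
  by rewrite (tnth_nth (@mnm0 k)) index_uniq ?fset_uniq ?ltn_ord.
by rewrite valK.
Qed.

Lemma correct_card D S : correct D (mspan S) -> #|` S| = #|` D|.
Proof.
move=> cDS; apply/eqP; rewrite eqn_leq; apply/andP; split.
  have /eqP <- : row_free (design_mx D S)^T; last exact: rank_leq_col.
  apply/row_freeP/row_freeP/inj_row_free => u uX.
  have [c uE] := coef_col u^T.
  have [p [_ puniq]] := cDS (fun=> 0).
  have S0 : \sum_(s <- S) c s *: monomial s = 0.
    rewrite -(puniq (\sum_(s <- S) c s *: monomial s)).
      apply: puniq; split; first by exists (fun=> 0); rewrite big1// => *; rewrite scale0r.
      by move=> d _; rewrite /peval raddf0.
    split; first by exists c.
    move=> d dD; have /tnthP[i ->] : d \in in_tuple D by [].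
    by rewrite -design_mxE -uE -(trmxK (design_mx D S)) -trmx_mul uX trmx0 mxE.
  apply: trmx_inj; rewrite uE trmx0; apply/colP => j; rewrite !mxE.
  by apply: monomial_sum_inj S0; exact: mem_tnth.
rewrite -[leqLHS](@mxrank1 C).
apply: leq_trans (rank_leq_row (design_mx D S)^T); apply: mxrankS.
apply/row_subP => i.
have [p [[[c ->] cE] _]] := cDS (fun d => (d == tnth (in_tuple D) i)%:R).
apply/submxP; exists (\col_j c (tnth (in_tuple S) j))^T.
apply: trmx_inj; rewrite trmx_mul !trmxK; apply/colP => j.
rewrite design_mxE cE ?mem_tnth// !mxE; congr (_%:R); congr nat_of_bool.
by rewrite !(tnth_nth 0) nth_uniq ?fset_uniq//= ?ltn_ord// eq_sym.
Qed.

(* The matrix is rectangular as typed; the cast along [#|S| = #|D|], which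
   [correct_card] provides for correct pairs, makes it square. *)
Definition weights (nu : {measure set (cspace R k) -> \bar R}) D S
    (e : #|` S| = #|` D|) : 'cV[C]_(#|` D|) :=
  invmx (castmx (e, erefl) (design_mx D S)^T) *m
  castmx (e, erefl) (moments nu S).

End quadrature.

(* Main.v *)
Require Import Defs.
From HB Require Import structures.
From mathcomp Require Import all_boot all_order all_algebra.
From mathcomp Require Import cyclic separable cyclotomic ring.
From mathcomp Require Import complex finmap.
From mathcomp Require Import -(notations) mpoly.
From mathcomp Require Import all_classical all_reals all_analysis.
From mathcomp Require Import measurable_realfun.

(** The proof has an analytic half and an algebraic half, which meet in a linear
    system for the weights.

    Analytic half: a zero-mean complex Gaussian measure is circular, so every
    monomial moment vanishes except that of the constant [1]
    ([gaussian_moment]).  Indeed multiplying all coordinates by a complex number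
    [w] of modulus 1 preserves both the density, a function of a Hermitian form,
    and Lebesgue measure on C^k ([preserves_gaussian]); and it multiplies [z^a]
    by [w^|a|].  If [|a| > 0], choose [w] with [w^|a| = i]: applying the rotation
    twice changes the sign of [z^a], so its real and imaginary parts integrate
    to 0.  The rotation invariance of Lebesgue measure comes from Fubini and
    translation invariance only: a rotation of the plane is a product of three
    shears ([preserves_cmul]).

    Algebraic half: the columns [z^a] of the full grid are orthogonal, so the
    coefficient of [z^a] in the indicator of [D] is, up to the factor [m^k], the
    conjugate of [sum_(d in D) d^a] ([indicator_coef]); hence [z^a] is in the
    support iff this power sum is nonzero ([mem_supp_indicator]).

    Conclusion: constant weights [c] mean that [c * sum_(d in D) s(d)] is the
    moment of [s] for every [s] in [S] ([weights_const_iff]).  With [c = 1/n] the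
    equation for [s = 1] always holds, and the one for [s <> 1] says that [s] is
    outside the support.  What remains is that [1] must belong to [S]: otherwise
    all the moments are 0, and so are the weights. *)

Set Implicit Arguments.
Unset Strict Implicit.
Unset Printing Implicit Defensive.

Import Order.TTheory GRing.Theory Num.Theory.
Local Open Scope classical_set_scope.
Local Open Scope ring_scope.

(** * Measure-preserving maps *)

Definition preserves d (T : measurableType d) (R : realType)
    (mu : set T -> \bar R) (g : T -> T) :=
  measurable_fun setT g /\ forall A, measurable A -> mu (g @^-1` A) = mu A.

Section preserving.
Context d (T : measurableType d) (R : realType).
Implicit Types (mu : {measure set T -> \bar R}) (g : T -> T).

Lemma preserves_comp (mu : set T -> \bar R) g h :
  preserves mu g -> preserves mu h -> preserves mu (g \o h).
Proof.
move=> [mg gE] [mh hE]; split=> [|A mA]; first exact: measurableT_comp.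
rewrite comp_preimage hE ?gE// -[X in measurable X]setTI.
exact: mg.
Qed.

Lemma ge0_integral_preserves mu g (D : set T) (f : T -> \bar R) :
  preserves mu g -> measurable D -> measurable_fun D f ->
  (forall x, 0 <= f x)%E ->
  (\int[mu]_(x in g @^-1` D) f (g x) = \int[mu]_(x in D) f x)%E.
Proof.
move=> [mg gE] mD mf f0.
rewrite -[LHS]/(\int[mu]_(x in g @^-1` D) (f \o g) x)%E.
rewrite -ge0_integral_pushforward//.
by apply: eq_measure_integral => A mA _; exact: gE.
Qed.

(** Both sides are the difference of the integrals of the positive and negative
    parts, which agree separately: this is why any measurable [f] will do. *)
Lemma integral_preserves mu g (D : set T) (f : T -> \bar R) :
  preserves mu g -> measurable D -> measurable_fun D f ->
  (\int[mu]_(x in g @^-1` D) f (g x) = \int[mu]_(x in D) f x)%E.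
Proof.
move=> pg mD mf; rewrite integralE [RHS]integralE.
rewrite -/(f \o g) funepos_comp funeneg_comp.
congr (_ - _)%E.
  exact: (ge0_integral_preserves pg mD (measurable_funepos mf) (funepos_ge0 f)).
exact: (ge0_integral_preserves pg mD (measurable_funeneg mf) (funeneg_ge0 f)).
Qed.

(** The map exchanges the positive and the negative part of [f], so their
    integrals are the same [p].  If [p] is infinite, the integral of [f] is
    [+oo - +oo], an infinite value that [fine] sends to 0. *)
Lemma Rintegral_preserves_antisym mu g (f : T -> R) :
  preserves mu g -> measurable_fun setT f -> (forall x, f (g x) = - f x) ->
  \int[mu]_x f x = 0.
Proof.
move=> pg mf fgN; rewrite /Rintegral integralE.
set p := (\int[mu]_x ((fun x => (f x)%:E)^\+)%E x)%E.
set q := (\int[mu]_x ((fun x => (f x)%:E)^\-)%E x)%E.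
suff -> : q = p.
  case: p => [r| |]//=; by rewrite subrr.
rewrite /p -(ge0_integral_preserves pg)//; last first.
  by apply: measurable_funepos; exact/measurable_EFinP.
rewrite preimage_setT; apply: eq_integral => x _.
by rewrite funeposE funenegE fgN EFinN.
Qed.

End preserving.

(** Cavalieri's principle: slice by the first coordinate.  Each slice is moved
    by a map preserving [m2], and the slices are permuted by a map preserving
    [m1].  This covers both the shears of the plane ([g] the identity) and the
    products of two preserving maps ([h] constant). *)
Lemma preserves_skew d1 d2 (T1 : measurableType d1) (T2 : measurableType d2)
    (R : realType) (m1 : {measure set T1 -> \bar R})
    (m2 : {sigma_finite_measure set T2 -> \bar R})
    (g : T1 -> T1) (h : T1 -> T2 -> T2) :
  preserves m1 g -> (forall x, preserves m2 (h x)) ->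
  measurable_fun setT (fun p : T1 * T2 => h p.1 p.2) ->
  preserves (m1 \x m2)%E (fun p => (g p.1, h p.1 p.2)).
Proof.
move=> pg ph mh; split=> [|A mA].
  apply/measurable_fun_pairP; split => //.
  exact: (measurableT_comp pg.1).
rewrite /product_measure1.
rewrite -[RHS](ge0_integral_preserves pg)//; last first.
  exact: measurable_fun_xsection.
rewrite preimage_setT; apply: eq_integral => x _ /=.
rewrite -[RHS](ph x).2; last exact: measurable_xsection.
by congr (m2 _); apply/seteqP; split=> y; rewrite /xsection/= !inE.
Qed.

(** * Rotation invariance of Lebesgue measure *)

Section rotation.
Variable R : realType.
Local Notation mu := (@lebesgue_measure R).

Lemma preserves_translation (a : R) :
  preserves mu (fun x : measurableTypeR R => x + a : measurableTypeR R).
Proof.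
have ma : measurable_fun setT
    (fun x : measurableTypeR R => x + a : measurableTypeR R).
  exact: measurable_funD.
split=> // A mA; apply/esym.
rewrite -[RHS]/(pushforward mu
  (fun x : measurableTypeR R => x + a : measurableTypeR R) A).
apply: lebesgue_measure_unique => //= _ [[u v]] _ <-.
rewrite /pushforward (_ : _ @^-1` _ = `]u - a, v - a]%classic); last first.
  by apply/seteqP; split=> x /=; rewrite !in_itv/= ltrBlDr lerBrDr.
rewrite !lebesgue_measure_itv/= !lte_fin ltrD2r -!EFinB.
by rewrite opprB addrA subrK.
Qed.

Definition cswap (z : cplane R) : cplane R := (z.2, z.1).

Lemma preserves_cswap : preserves (lebesgueC R) cswap.
Proof.
have ms : measurable_fun setT cswap.
  by apply/measurable_fun_pairP; split;
    [exact: measurable_snd|exact: measurable_fst].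
split=> // A mA; apply/esym.
rewrite -[RHS]/(pushforward (lebesgueC R) cswap A).
apply: product_measure_unique => //= B C mB mC /=.
rewrite /pushforward (_ : _ @^-1` _ = C `*` B); last first.
  by apply/seteqP; split => z [].
by rewrite /lebesgueC/= /sfproduct product_measure1E// muleC.
Qed.

Definition cshear (s : R) (z : cplane R) : cplane R := (z.1, z.2 + z.1 * s).

Lemma preserves_cshear s : preserves (lebesgueC R) (cshear s).
Proof.
apply: (@preserves_skew _ _ _ _ R mu mu id
  (fun x y : measurableTypeR R => y + x * s : measurableTypeR R)).
- by split.
- by move=> x; exact: preserves_translation.
- by apply: measurable_funD => //; apply: measurable_funM.
Qed.

Definition cmul (w : R[i]) (z : cplane R) : cplane R :=
  (complex.Re w * z.1 - complex.Im w * z.2,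
   complex.Re w * z.2 + complex.Im w * z.1).

(** With [w = c + i s] and [t = (c - 1) / s], the rotation [cmul w] factors as
    [(x, y) |-> (x + t y, y)], then [(x, y) |-> (x, y + s x)], then the first
    shear again; a shear along the other axis is obtained by conjugating with
    [cswap].  Dividing by [s] forces [w] not to be real. *)
Lemma preserves_cmul (w : R[i]) : `|w| = 1 -> complex.Im w != 0 ->
  preserves (lebesgueC R) (cmul w).
Proof.
case: w => c s /= w1 s0.
have cs1 : c ^+ 2 + s ^+ 2 = 1.
  move: w1; rewrite normc_def => -[] /(congr1 (fun x => x ^+ 2)).
  by rewrite expr1n sqr_sqrtr// addr_ge0// sqr_ge0.
pose t := (c - 1) / s.
have -> : cmul (Complex c s) = (cswap \o cshear t \o cswap) \o cshear s \o
    (cswap \o cshear t \o cswap).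
  apply/funext => -[x y]; rewrite /cmul/cswap/cshear/=.
  have ts : t * s = c - 1 by rewrite /t divfK.
  have tc : t * (c + 1) = - s.
    apply: (mulIf s0); rewrite mulrAC ts mulNr -expr2.
    by rewrite (_ : s ^+ 2 = 1 - c ^+ 2); [ring|rewrite -cs1 addrAC subrr add0r].
  congr pair.
    transitivity (x * (1 + t * s) + y * (t * (1 + (1 + t * s)))); last by ring.
    by rewrite ts addrCA subrr addr0 [1 + c]addrC tc; ring.
  transitivity (y * (1 + t * s) + x * s); last by ring.
  by rewrite ts; ring.
by do ![apply: preserves_comp|exact: preserves_cshear|exact: preserves_cswap].
Qed.

Definition ckmul (w : R[i]) k (t : cspace R k) : cspace R k :=
  [tuple cmul w (tnth t i) | i < k].

Lemma measurable_cmul w : measurable_fun setT (cmul w).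
Proof.
by apply/measurable_fun_pairP; split; rewrite /comp/=;
  [apply: measurable_funB|apply: measurable_funD]; apply: measurable_funM.
Qed.

Lemma measurable_ckmul w k : measurable_fun setT (@ckmul w k).
Proof.
apply/measurable_fun_tnthP => i.
rewrite (_ : _ \o _ = cmul w \o (fun t => tnth t i)); last first.
  by apply/funext => t; rewrite /= tnth_mktuple.
exact: measurableT_comp (measurable_cmul w) (measurable_tnth i).
Qed.

Lemma preserves_ckmul w k : `|w| = 1 -> complex.Im w != 0 ->
  preserves (lebesgueCk R k) (@ckmul w k).
Proof.
move=> w1 w0; elim: k => [|k [mk IH]].
  split=> [|A mA]; first exact: measurable_ckmul.
  by rewrite (_ : _ @^-1` A = A)//; apply/seteqP; split=> t;
    rewrite /= (tuple0 t) (tuple0 (ckmul _ _)).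
split=> [|A mA]; first exact: measurable_ckmul.
rewrite /= /lebesgueCS /pushforward -comp_preimage.
have mcA : measurable (@ccons R k @^-1` A).
  by rewrite -[X in measurable X]setTI; exact: measurable_ccons.
have pp : preserves (sfproduct (lebesgueC R) (lebesgueCk R k))
    (fun p => (cmul w p.1, ckmul w p.2)).
  apply: (@preserves_skew _ _ _ _ R (lebesgueC R) (lebesgueCk R k) (cmul w)
    (fun=> @ckmul w k)); first exact: preserves_cmul.
  - by [].
  - exact: measurableT_comp mk measurable_snd.
rewrite -[RHS]pp.2// -comp_preimage; congr (sfproduct _ _ (_ @^-1` A)).
apply/funext => -[z t]; apply: eq_from_tnth => i; rewrite [LHS]tnth_mktuple /comp.
case: (unliftP ord0 i) => [j ->|->]; last by rewrite !tnth0.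
by rewrite !tnthS tnth_mktuple.
Qed.

End rotation.

(** * Measurability of complex functions *)

Section complex_measurability.
Context d (T : measurableType d) (R : realType).
Implicit Types F G : T -> R[i].

Definition cmeasurable F :=
  measurable_fun setT (fun x => complex.Re (F x)) /\
  measurable_fun setT (fun x => complex.Im (F x)).

Lemma cmeasurable_cst c : cmeasurable (fun=> c).
Proof. by split; exact: measurable_cst. Qed.

Lemma cmeasurableD F G :
  cmeasurable F -> cmeasurable G -> cmeasurable (fun x => F x + G x).
Proof.
move=> [F1 F2] [G1 G2]; split.
  under eq_fun do rewrite raddfD/=.
  exact: measurable_funD.
under eq_fun do rewrite raddfD/=.
exact: measurable_funD.
Qed.

Lemma cmeasurableM F G :
  cmeasurable F -> cmeasurable G -> cmeasurable (fun x => F x * G x).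
Proof.
move=> [F1 F2] [G1 G2]; split.
  rewrite (_ : (fun x => _) = (fun x => complex.Re (F x) * complex.Re (G x) -
      complex.Im (F x) * complex.Im (G x))).
    by apply: measurable_funB; exact: measurable_funM.
  by apply/funext => x; case: (F x) (G x) => [? ?] [].
rewrite (_ : (fun x => _) = (fun x => complex.Re (F x) * complex.Im (G x) +
    complex.Im (F x) * complex.Re (G x))).
  by apply: measurable_funD; exact: measurable_funM.
by apply/funext => x; case: (F x) (G x) => [? ?] [].
Qed.

Lemma cmeasurable_conj F : cmeasurable F -> cmeasurable (fun x => (F x)^*).
Proof.
move=> [F1 F2]; split.
  by rewrite (_ : (fun x => _) = (fun x => complex.Re (F x)))//;
    apply/funext => x; case: (F x).
rewrite (_ : (fun x => _) = (fun x => - complex.Im (F x))).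
  exact: measurable_funN.
by apply/funext => x; case: (F x).
Qed.

Lemma cmeasurable_sum I (r : seq I) (F : I -> T -> R[i]) :
  (forall i, cmeasurable (F i)) -> cmeasurable (fun x => \sum_(i <- r) F i x).
Proof.
move=> mF; elim: r => [|i r IH].
  under eq_fun do rewrite big_nil.
  exact: cmeasurable_cst.
under eq_fun do rewrite big_cons.
exact: cmeasurableD.
Qed.

Lemma cmeasurable_prod I (r : seq I) (F : I -> T -> R[i]) :
  (forall i, cmeasurable (F i)) -> cmeasurable (fun x => \prod_(i <- r) F i x).
Proof.
move=> mF; elim: r => [|i r IH].
  under eq_fun do rewrite big_nil.
  exact: cmeasurable_cst.
under eq_fun do rewrite big_cons.
exact: cmeasurableM.
Qed.

Lemma cmeasurableX F n : cmeasurable F -> cmeasurable (fun x => F x ^+ n).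
Proof.
move=> mF; elim: n => [|n IH]; first exact: cmeasurable_cst.
under eq_fun do rewrite exprS.
exact: cmeasurableM.
Qed.

End complex_measurability.

(** * Moments of a circular Gaussian measure *)

Section gaussian_invariance.
Variables (R : realType) (k : nat).
Implicit Types (w : R[i]) (Sigma : 'M[R[i]]_k) (t : cspace R k).

Lemma cvec_ckmul w t : cvec (ckmul w t) = w *: cvec t.
Proof.
by apply/colP => i; rewrite !mxE tnth_mktuple; case: w (tnth t i) => [? ?] [].
Qed.

Lemma cmeasurable_cvec (i : 'I_k) : cmeasurable (fun t => cvec t i ord0).
Proof.
split; under eq_fun do rewrite mxE/=.
  exact: measurableT_comp measurable_fst (measurable_tnth i).
exact: measurableT_comp measurable_snd (measurable_tnth i).
Qed.

Lemma measurable_gaussian_density Sigma :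
  measurable_fun setT (fun t => gaussian_density Sigma (cvec t)).
Proof.
apply: measurable_funM => //; apply: measurableT_comp => //.
apply: measurable_funN.
have [] // : cmeasurable (fun t : cspace R k =>
  ((map_mx Num.conj (cvec t)^T) *m invmx Sigma *m cvec t) ord0 ord0).
under eq_fun do rewrite mxE.
apply: cmeasurable_sum => i; apply: cmeasurableM; last exact: cmeasurable_cvec.
under eq_fun do rewrite mxE.
apply: cmeasurable_sum => j; apply: cmeasurableM; last exact: cmeasurable_cst.
under eq_fun do rewrite 2!mxE.
exact/cmeasurable_conj/cmeasurable_cvec.
Qed.

Lemma gaussian_densityZ Sigma w (z : 'cV[R[i]]_k) : `|w| = 1 ->
  gaussian_density Sigma (w *: z) = gaussian_density Sigma z.
Proof.
move=> w1; rewrite /gaussian_density !linearZ/= map_mxZ.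
rewrite -!scalemxAl scalerA.
by rewrite -normCK w1 expr1n scale1r.
Qed.

Lemma preserves_gaussian Sigma (nu : probability (cspace R k) R) w :
  is_complex_gaussian Sigma nu -> `|w| = 1 -> complex.Im w != 0 ->
  preserves nu (@ckmul R w k).
Proof.
move=> nuG w1 w0; have pw := @preserves_ckmul R w k w1 w0.
split=> [|A mA]; first exact: pw.1.
have mgA : measurable (@ckmul R w k @^-1` A).
  by rewrite -[X in measurable X]setTI; exact: pw.1.
rewrite (nuG _ mgA) (nuG _ mA).
rewrite -[RHS](integral_preserves pw mA); last first.
  apply/measurable_EFinP.
  by apply: measurable_funTS; exact: measurable_gaussian_density.
by apply: eq_integral => t _; rewrite cvec_ckmul gaussian_densityZ.
Qed.

(** Asking for a root of [i] rather than of [-1] keeps [w] away from the real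
    axis: a real [w] has real powers. *)
Lemma exists_rotation_root_i d : (0 < d)%N ->
  exists w, [/\ `|w| = 1, complex.Im w != 0 & w ^+ d = Complex (0 : R) 1].
Proof.
move=> d_gt0; pose w : R[i] := d.-root (Complex 0 1); exists w.
have wd : w ^+ d = Complex 0 1 by rewrite /w rootCK.
split=> //.
  apply/eqP; rewrite -(@pexpr_eq1 _ _ d)// -normrX wd.
  by rewrite normc_def/= expr0n expr1n add0r sqrtr1.
apply/eqP; move: wd; case: w => x y /= /[swap] ->.
rewrite -[Complex x 0]/(x%:C)%C -rmorphXn/= => -[_ /eqP].
by rewrite eq_sym oner_eq0.
Qed.

Lemma peval_monomial (a : multinom k) (z : 'cV[R[i]]_k) :
  peval (monomial R a) z = \prod_i z i ord0 ^+ a i.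
Proof. exact: mevalX. Qed.

Lemma peval_monomial0 (z : 'cV[R[i]]_k) : peval (monomial R (@mnm0 k)) z = 1.
Proof. by rewrite peval_monomial big1// => i _; rewrite mnmE. Qed.

Lemma cmeasurable_monomial (a : multinom k) :
  cmeasurable (fun t => peval (monomial R a) (cvec t)).
Proof.
under eq_fun do rewrite peval_monomial.
by apply: cmeasurable_prod => i; apply/cmeasurableX/cmeasurable_cvec.
Qed.

Lemma peval_monomialZ (a : multinom k) w z :
  peval (monomial R a) (w *: z) = w ^+ mdeg a * peval (monomial R a) z.
Proof.
rewrite !peval_monomial mdegE expr_sum -big_split/=.
by apply: eq_bigr => i _; rewrite mxE exprMn.
Qed.

(** Two rotations by a root [w] of [i] multiply [z^a] by [i * i = -1]. *)
Lemma gaussian_moment Sigma (nu : probability (cspace R k) R) (a : multinom k) :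
  is_complex_gaussian Sigma nu ->
  cintegral nu (peval (monomial R a)) = (a == @mnm0 k)%:R.
Proof.
move=> nuG; have [->|a0] := eqVneq.
  rewrite /cintegral.
  under eq_Rintegral do rewrite peval_monomial0 /=.
  under [X in Complex _ X]eq_Rintegral do rewrite peval_monomial0 /=.
  rewrite !Rintegral_cst//.
  set p := fine _.
  have -> : p = 1 by exact: (congr1 fine (probability_setT nu)).
  rewrite mulr1 mul0r.
  by [].
have [w [w1 wI wa]] : exists w : R[i],
    [/\ `|w| = 1, complex.Im w != 0 & w ^+ mdeg a = Complex 0 1].
  by apply: exists_rotation_root_i; rewrite lt0n mdeg_eq0.
have pw := preserves_gaussian nuG w1 wI.
have pww := preserves_comp pw pw.
have fN t : peval (monomial R a) (cvec (ckmul w (ckmul w t))) =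
    - peval (monomial R a) (cvec t).
  rewrite !cvec_ckmul !peval_monomialZ mulrA wa.
  by case: (peval _ _) => x y; congr Complex => /=; ring.
have [mRe mIm] := cmeasurable_monomial a.
rewrite /cintegral (Rintegral_preserves_antisym pww mRe); last first.
  by move=> t /=; rewrite fN raddfN.
rewrite (Rintegral_preserves_antisym pww mIm)// => t /=.
by rewrite fN raddfN.
Qed.

End gaussian_invariance.

(** * Orthogonality of monomials on the grid of roots of unity *)

Section unity_roots.
Variables (C : numClosedFieldType) (m : nat).
Hypothesis m_gt0 : (0 < m)%N.

Lemma exists_primitive_root : exists z : C, m.-primitive_root z.
Proof.
pose p : {poly C} := 'X^m - 1.
have [r] := closed_field_poly_normal p.
rewrite (monicP _) ?monicXnsubC// scale1r => Dp.
have rn1 : all m.-unity_root r.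
  by apply/allP => z; rewrite -root_prod_XsubC -Dp.
have sz_r : (m < (size r).+1)%N.
  by rewrite -(size_prod_XsubC r id) -Dp size_XnsubC.
have [|z] := hasP (has_prim_root m_gt0 rn1 _ sz_r); last by exists z.
by rewrite -separable_prod_XsubC -Dp separable_Xn_sub_1// pnatr_eq0 -lt0n.
Qed.

Lemma norm_unity_root (z : C) : z ^+ m = 1 -> `|z| = 1.
Proof.
by move=> zm; apply/eqP; rewrite -(@pexpr_eq1 _ _ m)// -normrX zm normr1.
Qed.

Lemma sum_expr_unity_root (z : C) : z ^+ m = 1 ->
  \sum_(j < m) z ^+ j = (z == 1)%:R * m%:R.
Proof.
move=> zm; have [->|z1] := eqVneq.
  under eq_bigr do rewrite expr1n.
  by rewrite sumr_const card_ord mul1r.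
rewrite mul0r; apply: (mulfI (x := z - 1)); first by rewrite subr_eq0.
by rewrite -subrX1 zm subrr mulr0.
Qed.

(** A geometric sum of ratio [z ^+ a * (z ^+ b)^*], an [m]-th root of unity that
    is 1 only for [a = b], since both exponents are below [m]. *)
Lemma sum_prim_root_orthogonal (z : C) (a b : nat) :
  m.-primitive_root z -> (a < m)%N -> (b < m)%N ->
  \sum_(j < m) (z ^+ j) ^+ a * ((z ^+ j) ^+ b)^* = (a == b)%:R * m%:R.
Proof.
move=> zP am bm; have zm := prim_expr_order zP.
have zb : z ^+ b * (z ^+ b)^* = 1.
  by rewrite -normCK normrX norm_unity_root// !expr1n.
under eq_bigr => j _.
  rewrite -!exprM mulnC [(j * b)%N]mulnC !exprM rmorphXn -exprMn.
  over.
rewrite sum_expr_unity_root.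
  congr (_%:R * _); congr nat_of_bool; apply/eqP/eqP => [ab1|->//].
  apply/eqP; rewrite -(modn_small am) -(modn_small bm).
  rewrite -(eq_prim_root_expr zP); apply/eqP.
  by rewrite -[RHS]mul1r -ab1 mulrAC -mulrA zb mulr1.
rewrite exprMn -rmorphXn -!exprM mulnC [(b * m)%N]mulnC !exprM zm !expr1n.
by rewrite rmorph1 mulr1.
Qed.

End unity_roots.

Section indicator.
Variables (R : realType) (k m : nat).
Hypothesis m_gt0 : (0 < m)%N.
Local Notation C := R[i].
Variable zeta : C.
Hypothesis zetaP : m.-primitive_root zeta.

Definition grid_point (x : {ffun 'I_k -> 'I_m}) : 'cV[C]_k :=
  \col_i zeta ^+ x i.

Lemma grid_point_inj : injective grid_point.
Proof.
move=> x y /colP xy; apply/ffunP => i; apply/val_inj/eqP => /=.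
rewrite -(modn_small (ltn_ord (x i))) -(modn_small (ltn_ord (y i))).
by rewrite -(eq_prim_root_expr zetaP); have := xy i; rewrite !mxE => ->.
Qed.

Lemma roots_gridP z : roots_grid m z -> exists x, z = grid_point x.
Proof.
move=> zm; have /fin_all_exists[x xE] i : exists j : 'I_m, z i ord0 = zeta ^+ j.
  by have [j ->] := prim_rootP zetaP (zm i); exists j.
by exists (finfun x); apply/colP => i; rewrite mxE ffunE xE.
Qed.

Lemma roots_grid_point x : roots_grid m (grid_point x).
Proof.
by move=> i; rewrite mxE -exprM mulnC exprM (prim_expr_order zetaP) expr1n.
Qed.

Lemma monomials_ltP (a : multinom k) :
  a \in monomials_lt k m -> forall i, (a i < m)%N.
Proof.
rewrite inE => /mapP[x _ ->] i.
by rewrite /exponent multinomE tnth_mktuple.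
Qed.

(** The sum over the grid factors into [k] sums over the [m]-th roots of unity. *)
Lemma sum_monomial_orthogonal (a b : multinom k) :
  a \in monomials_lt k m -> b \in monomials_lt k m ->
  \sum_(x : {ffun 'I_k -> 'I_m}) peval (monomial R a) (grid_point x) *
    (peval (monomial R b) (grid_point x))^* = (a == b)%:R * (m ^ k)%:R.
Proof.
move=> /monomials_ltP am /monomials_ltP bm.
pose F i (j : 'I_m) := (zeta ^+ j) ^+ a i * ((zeta ^+ j) ^+ b i)^*.
transitivity (\sum_(x : {ffun 'I_k -> 'I_m}) \prod_i F i (x i)).
  apply: eq_bigr => x _; rewrite !peval_monomial rmorph_prod -big_split/=.
  by apply: eq_bigr => i _; rewrite mxE.
rewrite -bigA_distr_bigA/=.
under eq_bigr do rewrite sum_prim_root_orthogonal//.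
rewrite big_split/= prodr_const card_ord natrX; congr (_ * _).
have [->|ab] := eqVneq; first by rewrite big1// => i _; rewrite eqxx.
have [i abi] : exists i, a i != b i.
  apply/existsP; apply: contraR ab; rewrite negb_exists => /forallP ab.
  by apply/eqP/mnmP => i; apply/eqP; have := ab i; rewrite negbK.
by rewrite (bigD1 i)//= (negbTE abi) mul0r.
Qed.

Lemma sum_grid_indicator (D : {fset 'cV[C]_k}) (F : 'cV[C]_k -> C) :
  [set` D] `<=` roots_grid m ->
  \sum_x (grid_point x \in D)%:R * F (grid_point x) = \sum_(d <- D) F d.
Proof.
move=> DG; transitivity (\sum_(x | grid_point x \in D) F (grid_point x)).
  by rewrite [RHS]big_mkcond; apply: eq_bigr => x _; case: ifP;
    rewrite ?mul1r ?mul0r.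
rewrite -big_filter -(big_map grid_point predT F); apply: perm_big.
apply: uniq_perm => [||z].
- by rewrite (map_inj_uniq grid_point_inj) filter_uniq// index_enum_uniq.
- exact: fset_uniq.
apply/mapP/idP => [[x]|zD]; first by rewrite mem_filter => /andP[? _] ->.
have [x zE] := roots_gridP (DG z zD).
by exists x => //; rewrite mem_filter -zE zD mem_index_enum.
Qed.

(** Summing [f(z)] times the conjugate of [z^a] over the grid computes the left
    side by orthogonality, and the right side because [f] is the indicator of
    [D]. *)
Lemma indicator_coef (D : {fset 'cV[C]_k}) (f : mpoly k C) (a : multinom k) :
  [set` D] `<=` roots_grid m -> is_indicator_poly m D f ->
  a \in monomials_lt k m ->
  mcoeff a f * (m ^ k)%:R = (\sum_(d <- D) peval (monomial R a) d)^*.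
Proof.
move=> DG [[c fE] fD] aL; rewrite rmorph_sum.
rewrite -(sum_grid_indicator (fun d => (peval (monomial R a) d)^*) DG).
transitivity (\sum_(x : {ffun 'I_k -> 'I_m}) \sum_(b <- monomials_lt k m) c b *
    (peval (monomial R b) (grid_point x) *
     (peval (monomial R a) (grid_point x))^*)); last first.
  apply: eq_bigr => x _; rewrite -(fD _ (roots_grid_point x)) fE peval_sum.
  by rewrite mulr_suml; apply: eq_bigr => b _; rewrite mulrA.
rewrite exchange_big/=.
under eq_big_seq => b bL do rewrite -mulr_sumr sum_monomial_orthogonal// mulrA.
rewrite -mulr_suml; congr (_ * _); rewrite fE raddf_sum /=.
by apply: eq_bigr => b _; rewrite mcoeffZ mcoeffX.
Qed.

End indicator.

(** * Constant quadrature weights *)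

Lemma invmx_castmx_eq (F : fieldType) p q (e : p = q) (A : 'M[F]_(p, q))
    (b : 'cV_p) v : row_full A ->
  invmx (castmx (e, erefl) A) *m castmx (e, erefl) b = v <-> A *m v = b.
Proof.
case: q / e A v => A v; rewrite row_full_unit !castmx_id => A_unit.
by split=> [<-|<-]; [exact: mulKVmx|exact: mulKmx].
Qed.

Section constant_weights.
Variables (R : realType) (k : nat).
Local Notation C := R[i].

Lemma mem_supp_indicator m (D : {fset 'cV[C]_k}) (f : mpoly k C)
    (a : multinom k) : (0 < m)%N ->
  [set` D] `<=` roots_grid m -> is_indicator_poly m D f ->
  a \in monomials_lt k m ->
  (a \in supp f) = (\sum_(d <- D) peval (monomial R a) d != 0).
Proof.
move=> m_gt0 DG fD aL; have [zeta zetaP] := exists_primitive_root C m_gt0.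
rewrite inE mcoeff_msupp -(conjC_eq0 (\sum_(d <- D) _)).
rewrite -(indicator_coef m_gt0 zetaP DG fD aL) mulf_eq0 negb_or.
by rewrite pnatr_eq0 expn_eq0 eqn0Ngt m_gt0 andbT.
Qed.

(** Interpolating the indicator of each node gives the columns of a right inverse
    of the design matrix. *)
Lemma row_full_design (D : {fset 'cV[C]_k}) (S : {fset multinom k}) :
  correct D (mspan S) -> row_full (design_mx D S)^T.
Proof.
move=> DS.
have /fin_all_exists[c cE] (i : 'I_#|` D|) : exists c : multinom k -> C,
    forall d, d \in D -> peval (\sum_(s <- S) c s *: monomial R s) d =
      (d == tnth (in_tuple D) i)%:R.
  by have [_ [[[c ->] cE] _]] := DS (fun d => (d == tnth (in_tuple D) i)%:R);
    exists c.
apply/row_fullP; exists (\matrix_(i, j) c i (tnth (in_tuple S) j)).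
apply: trmx_inj; rewrite trmx_mul trmxK trmx1; apply/matrixP => i j.
have := design_mxE S (c j) i; rewrite cE ?mem_tnth//.
rewrite !(tnth_nth 0) nth_uniq ?fset_uniq//= => XcE.
rewrite [RHS]mxE -[RHS]XcE !mxE.
by apply: eq_bigr => l _; rewrite !mxE.
Qed.

Lemma weights_const_iff (nu : {measure set (cspace R k) -> \bar R})
    (D : {fset 'cV[C]_k}) (S : {fset multinom k})
    (DS : correct D (mspan S)) (c : C) :
  weights nu (correct_card DS) = const_mx c <->
  forall s, s \in S ->
    c * \sum_(d <- D) peval (monomial R s) d =
    cintegral nu (peval (monomial R s)).
Proof.
rewrite /weights invmx_castmx_eq; last exact: row_full_design.
have E j : ((design_mx D S)^T *m const_mx c : 'cV_ _) j ord0 =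
    c * \sum_(d <- D) peval (monomial R (tnth (in_tuple S) j)) d.
  rewrite mxE (big_tnth _ _ (enum_fset D)) mulr_sumr.
  by apply: eq_bigr => i _; rewrite !mxE mulrC.
split=> [/colP H s sS|H].
  have /tnthP[j ->] : s \in in_tuple S by [].
  by rewrite -E H mxE.
by apply/colP => j; rewrite E H ?mem_tnth// mxE.
Qed.

End constant_weights.

Theorem theorem5 (R : realType) (k m n : nat)
    (k_gt0 : (0 < k)%N) (m_gt0 : (0 < m)%N) (n_gt0 : (0 < n)%N)
    (Sigma : 'M[R[i]]_k) (Sigma_posdef : hermitian_posdef Sigma)
    (nu : probability (cspace R k) R) (nu_gauss : is_complex_gaussian Sigma nu)
    (D : {fset 'cV[R[i]]_k}) (D_grid : [set` D] `<=` roots_grid m)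
    (card_D : #|` D| = n)
    (f : mpoly k R[i]) (f_ind : is_indicator_poly m D f)
    (S : {fset multinom k}) (S_lt : (S `<=` monomials_lt k m)%fset)
    (DS_correct : correct D (mspan S)) :
  weights nu (correct_card DS_correct) = const_mx n%:R^-1 <->
  (S `&` supp f)%fset = [fset @mnm0 k]%fset.
Proof.
have nC : n%:R != 0 :> R[i] by rewrite pnatr_eq0 -lt0n.
have sum1 : \sum_(d <- D) peval (monomial R (@mnm0 k)) d = n%:R.
  under eq_bigr do rewrite peval_monomial0.
  by rewrite big_const_seq count_predT iter_addr_0 card_D.
have suppE s : s \in S ->
    (s \in supp f) = (\sum_(d <- D) peval (monomial R s) d != 0).
  move=> sS.
  by rewrite (mem_supp_indicator m_gt0 D_grid f_ind)// (fsubsetP S_lt).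
split=> [w_cst|SfE].
  have S1 : @mnm0 k \in S.
    apply: contraT => S1.
    (* Without [1] in [S] the moments vanish, so the weights are also constant 0. *)
    have w0 : weights nu (correct_card DS_correct) = const_mx 0.
      apply/weights_const_iff => s sS; rewrite mul0r (gaussian_moment _ nu_gauss).
      by have [s1|//] := eqVneq; rewrite -s1 sS in S1.
    have i0 : 'I_#|` D| by rewrite card_D; exact: Ordinal n_gt0.
    have /colP/(_ i0)/eqP := etrans (esym w_cst) w0.
    by rewrite !mxE invr_eq0 (negbTE nC).
  have wE := (weights_const_iff _ _ _).1 w_cst.
  apply/fsetP => s; rewrite in_fsetI in_fset1.
  apply/andP/eqP => [[sS]|->]; last by rewrite suppE// sum1.
  rewrite suppE//; apply: contraNeq => s1; have := wE s sS.
  rewrite (gaussian_moment _ nu_gauss) (negbTE s1) => /eqP.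
  by rewrite mulf_eq0 invr_eq0 (negbTE nC).
apply/weights_const_iff => s sS; rewrite (gaussian_moment _ nu_gauss).
have [->|s1] := eqVneq; first by rewrite sum1 mulVf.
have : s \notin supp f.
  apply: contra s1 => sf; rewrite -in_fset1 -SfE in_fsetI sS//.
by rewrite suppE// negbK => /eqP ->; rewrite mulr0.
Qed.
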